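(* There exists an isomorphism of $\mathbb{Q}(v^{1/2})$-algebras $$\widetilde{\Phi}:\widetilde{\mathcal H}(Q,\varrho)\longrightarrow \widetilde{\mathbf B}^{\imath}_{\varrho}(Q),\qquad \mathfrak u_\lambda*\mathbb K_\alpha\longmapsto v^{(\lambda,\alpha)_Q+\langle\alpha,\varrho\alpha\rangle_Q}\,\mathfrak u_\lambda\cdot \mathbb K_{(\varrho\alpha)^\diamond},\qquad \forall \lambda\in\mathfrak P,\ \alpha\in\mathbb Z^{\mathbb I}.$$
   Context: Setting. $Q$ is a Dynkin quiver (underlying graph a simply-laced Dynkin diagram, type ADE) with vertex set $\mathbb I=\{1,\dots,n\}$, and $\varrho$ is an involution of $Q$, i.e. a quiver automorphism with $\varrho^2=\mathrm{Id}$ (possibly $\varrho=\mathrm{Id}$). $\Phi^+$ is the set of positive roots, inside the root lattice $\mathbb Z^{\mathbb I}=\bigoplus_i\mathbb Z\alpha_i$; $\varrho$ acts on both. The Euler form is $\langle x,y\rangle_Q=\sum_i x_iy_i-\sum_{(i\to j)\in Q_1}x_iy_j$, and $(x,y)_Q=\langle x,y\rangle_Q+\langle y,x\rangle_Q$. For a finite field $\mathbb F_q$ and $\beta\in\Phi^+$, $M_q(\beta)$ is the indecomposable representation of $Q$ over $\mathbb F_q$ of dimension vector $\beta$. $\mathfrak P$ is the set of functions $\lambda:\Phi^+\to\mathbb N$; $M_q(\lambda)=\bigoplus_\beta M_q(\beta)^{\oplus\lambda(\beta)}$, with dimension vector $d^\lambda$; $(\varrho\lambda)(\beta)=\lambda(\varrho\beta)$.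 An element $\lambda\in\mathfrak P$ appearing in a bilinear form, in a sum with elements of $\mathbb Z^{\mathbb I}$, or as a subscript of $\mathbb K$ stands for $d^\lambda$. Hall polynomials. For modules $X,Y,Z$, $F_{XZ}^Y$ is the number of submodules $L\subseteq Y$ with $L\cong Z$, $Y/L\cong X$; $G_{XZ}^Y=|\mathrm{Ext}^1(X,Z)_Y|/|\mathrm{Hom}(X,Z)|$, where $\mathrm{Ext}^1(X,Z)_Y$ is the set of extension classes with middle term isomorphic to $Y$; $a_X=|\mathrm{Aut}(X)|$. There are $f_{\lambda,\mu}^{\nu}(v),g_{\lambda,\mu}^{\nu}(v),a_\lambda(v)\in\mathbb Z[v,v^{-1}]$ whose values at $v=\sqrt q$ are $F_{M_q(\lambda),M_q(\mu)}^{M_q(\nu)}$, $G_{M_q(\lambda),M_q(\mu)}^{M_q(\nu)}$, $a_{M_q(\lambda)}$ for every $q$. Generic iHall algebra. $\widetilde{\mathcal H}(Q,\varrho)$ (generic version of the twisted semi-derived Ringel–Hall algebra of the iquiver algebra of $(Q,\varrho)$) is the associative unital $\mathbb Q(v^{1/2})$-algebra with basis $\{\mathbb K_\alpha*\mathfrak u_\lambda\mid\alpha\in\mathbb Z^{\mathbb I},\lambda\in\mathfrak P\}$ and multiplication determined by $\mathbb K_0=\mathfrak u_0=1$, $\mathbb K_\alpha*\mathbb K_\beta=\mathbb K_{\alpha+\beta}$, $\mathbb K_\alpha*\mathfrak u_\lambda=v^{(\varrho\alpha,\lambda)_Q-(\alpha,\lambda)_Q}\mathfrak u_\lambda*\mathbb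 K_\alpha$, and $$\mathfrak u_\lambda*\mathfrak u_\mu=\sum_{\theta,\nu,\gamma,\delta\in\mathfrak P}v^{\langle\delta,\theta\rangle_Q-\langle\varrho\delta,\theta\rangle_Q-\langle\lambda,\mu\rangle_Q+2\langle\nu,\gamma\rangle_Q}a_\delta(v)f^\lambda_{\delta,\nu}(v)f^\mu_{\gamma,\varrho\delta}(v)g^\theta_{\nu,\gamma}(v)\,\mathbb K_\delta*\mathfrak u_\theta.$$ The Hopf algebra $\widetilde{\mathbf B}(Q)$ (extended Hall algebra). It has $\mathbb Q(v^{1/2})$-basis $\{\mathfrak u_\lambda\cdot\mathbb K_{\alpha^\diamond}\mid\lambda\in\mathfrak P,\alpha\in\mathbb Z^{\mathbb I}\}$ with multiplication $\mathfrak u_\lambda\cdot\mathfrak u_\mu=\sum_\nu v^{\langle\lambda,\mu\rangle_Q}g^\nu_{\lambda,\mu}(v)\mathfrak u_\nu$, $\mathbb K_{\alpha^\diamond}\cdot\mathbb K_{\beta^\diamond}=\mathbb K_{\alpha^\diamond+\beta^\diamond}$, $\mathbb K_{\alpha^\diamond}\cdot\mathfrak u_\lambda=v^{(\alpha,\lambda)_Q}\mathfrak u_\lambda\cdot\mathbb K_{\alpha^\diamond}$; coproduct $\Delta(\mathfrak u_\lambda)=\sum_{\mu,\nu}v^{\langle\mu,\nu\rangle_Q}f^\lambda_{\mu,\nu}(v)\,\mathfrak u_\mu\cdot\mathbb K_{\nu^\diamond}\otimes\mathfrak u_\nu$, $\Delta(\mathbb K_{\alpha^\diamond})=\mathbb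 K_{\alpha^\diamond}\otimes\mathbb K_{\alpha^\diamond}$; counit $\varepsilon(\mathfrak u_\lambda)=\delta_{\lambda,0}$, $\varepsilon(\mathbb K_{\alpha^\diamond})=1$. It carries the Hopf pairing $\varphi(\mathfrak u_\lambda\cdot\mathbb K_{\alpha^\diamond},\mathfrak u_\mu\cdot\mathbb K_{\beta^\diamond})=v^{(\alpha,\beta)_Q}\delta_{\lambda,\mu}a_\lambda(v)$, and $\varrho$ acts by $\varrho(\mathfrak u_\lambda\cdot\mathbb K_{\alpha^\diamond})=\mathfrak u_{\varrho\lambda}\cdot\mathbb K_{(\varrho\alpha)^\diamond}$. The iHopf algebra $\widetilde{\mathbf B}^\imath_\varrho(Q)$ is the vector space $\widetilde{\mathbf B}(Q)$ with the associative multiplication $a*b=\sum\varphi(\varrho(b_{(2)}),a_{(1)})\,a_{(2)}\cdot b_{(1)}$ (Sweedler notation). *)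

(* Defs.v *)
From HB Require Import structures.
From mathcomp Require Import all_boot all_order all_algebra all_field.
From mathcomp Require Import perm mxrepresentation.
From mathcomp Require Import finmap.
From mathcomp Require Import boolp classical_sets functions cardinality fsbigop.
From mathcomp Require Import monalg.

Set Implicit Arguments.
Unset Strict Implicit.
Unset Printing Implicit Defensive.

Import Order.TTheory GRing.Theory Num.Theory.
Local Open Scope ring_scope.

(** ** Dynkin quivers with involution *)

(* Simply-laced Dynkin diagrams on 'I_n.  In types D and E the vertices
   0, ..., n-2 form a path, and the vertex n-1 is attached to the vertex b,
   with b = n-3 in type D and b = 2 in type E. *)
Definition path_adj (i j : nat) : bool := (i.+1 == j) || (j.+1 == i).

Definition fork_edge (n b i j : nat) : bool :=
  ((i.+1 == j) && (j < n.-1)%N) || ((i == b) && (j == n.-1)).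

Definition fork_adj (n b i j : nat) : bool :=
  fork_edge n b i j || fork_edge n b j i.

Variant ADE_diagram (n : nat) : (nat -> nat -> bool) -> Prop :=
| ADE_A of (1 <= n)%N : ADE_diagram n path_adj
| ADE_D of (4 <= n)%N : ADE_diagram n (fork_adj n (n - 3))
| ADE_E of n \in [:: 6; 7; 8]%N : ADE_diagram n (fork_adj n 2).

Definition is_dynkin (n : nat) (Q1 : finType) (src tgt : Q1 -> 'I_n) : Prop :=
  exists2 adj, ADE_diagram n adj &
  exists s : {perm 'I_n}, forall i j : 'I_n,
    #|[set a | (src a == i) && (tgt a == j) || (src a == j) && (tgt a == i)]|
    = adj (s i) (s j).

(* rhoV and rhoA are the actions of the involution on vertices and arrows. *)
Record dynkin_iquiver : Type := DynkinIquiver {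
  nv : nat;
  arrow : finType;
  src : arrow -> 'I_nv;
  tgt : arrow -> 'I_nv;
  dynkinP : is_dynkin src tgt;
  rhoV : 'I_nv -> 'I_nv;
  rhoA : arrow -> arrow;
  rhoVK : involutive rhoV;
  rhoAK : involutive rhoA;
  rho_src : forall a, src (rhoA a) = rhoV (src a);
  rho_tgt : forall a, tgt (rhoA a) = rhoV (tgt a) }.

Section RootLattice.
Variable Q : dynkin_iquiver.

Definition lattice := {ffun 'I_(nv Q) -> int}.

Definition simple_root (i : 'I_(nv Q)) : lattice := [ffun j => (i == j)%:R].

Definition euler (x y : lattice) : int :=
  \sum_i x i * y i - \sum_(a : arrow Q) x (src a) * y (tgt a).

Definition sym_euler (x y : lattice) : int := euler x y + euler y x.

(* The coordinate of rho x at i is that of x at rho^-1 i = rho i. *)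
Definition rhoL (x : lattice) : lattice := [ffun i => x (rhoV i)].

Definition reflection (i : 'I_(nv Q)) (x : lattice) : lattice :=
  x - simple_root i *~ sym_euler x (simple_root i).

(* Roots: the orbits of the simple roots under the Weyl group. *)
Inductive is_root : lattice -> Prop :=
| root_simple i : is_root (simple_root i)
| root_reflection i x : is_root x -> is_root (reflection i x).

Definition is_posroot (x : lattice) : Prop :=
  is_root x /\ forall i, 0 <= x i.

(* The root system of a Dynkin diagram is finite, so this is the set of all
   positive roots and not the default value of fset_set. *)
Definition posroots : {fset lattice} :=
  fset_set (fun x : lattice => is_posroot x).

Lemma euler_rhoL x y : euler (rhoL x) (rhoL y) = euler x y.
Proof.
rewrite /euler; congr (_ - _).
  rewrite [RHS](reindex_inj (inv_inj (@rhoVK Q))) /=.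
  by apply: eq_bigr => i _; rewrite !ffunE.
rewrite [RHS](reindex_inj (inv_inj (@rhoAK Q))) /=.
by apply: eq_bigr => a _; rewrite !ffunE rho_src rho_tgt.
Qed.

Lemma rhoLK : involutive rhoL.
Proof. by move=> x; apply/ffunP=> i; rewrite !ffunE rhoVK. Qed.

Lemma rhoL_simple i : rhoL (simple_root i) = simple_root (rhoV i).
Proof.
by apply/ffunP=> j; rewrite !ffunE -{1}[i]rhoVK (inj_eq (inv_inj (@rhoVK Q))).
Qed.

Lemma rhoL_reflection i x :
  rhoL (reflection i x) = reflection (rhoV i) (rhoL x).
Proof.
rewrite /reflection -rhoL_simple /sym_euler !euler_rhoL.
have rhoLB y z : rhoL (y - z) = rhoL y - rhoL z.
  by apply/ffunP=> j; rewrite !ffunE.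
rewrite rhoLB; congr (_ - _); set c : int := euler _ _ + _.
have rhoLMn y m : rhoL (y *+ m) = rhoL y *+ m.
  by apply/ffunP=> j; rewrite !(ffunMnE, ffunE).
have rhoLN y : rhoL (- y) = - rhoL y by apply/ffunP=> j; rewrite !ffunE.
by case: c => m; rewrite ?NegzE ?mulrNz -?pmulrn ?rhoLN rhoLMn.
Qed.

Lemma rhoL_posroots x : x \in posroots -> rhoL x \in posroots.
Proof.
rewrite /posroots; set A := fun _ => _.
case: (pselect (finite_set A)) => [Afin|Ainf]; last first.
  by rewrite /fset_set; case: pselect.
rewrite !in_fset_set // !inE /A => -[xr x_ge0]; split; last first.
  by move=> i; rewrite ffunE.
by elim: xr => [i|i y _ IH]; rewrite ?rhoL_simple ?rhoL_reflection; constructor.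
Qed.

Definition rho_root (b : posroots) : posroots := [` rhoL_posroots (fsvalP b)]%fset.

Definition partition_fun := {ffun posroots -> nat}.

Definition dimL (l : partition_fun) : lattice := \sum_(b : posroots) val b *+ l b.

Definition rhoP (l : partition_fun) : partition_fun := [ffun b => l (rho_root b)].

End RootLattice.

(** ** Representations over a finite field *)

(* Linear maps act on row vectors, as in mxalgebra: x |-> x *m rep_map a. *)
Record rep (k : finFieldType) (Q : dynkin_iquiver) : Type := Rep {
  rep_dim : 'I_(nv Q) -> nat;
  rep_map : forall a : arrow Q, 'M[k]_(rep_dim (src a), rep_dim (tgt a)) }.

Section Rep.
Variables (k : finFieldType) (Q : dynkin_iquiver).
Implicit Types X Y Z : rep k Q.

Definition zero_rep : rep k Q := @Rep k Q (fun=> 0%N) (fun=> 0).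

Definition dsum_rep X Y : rep k Q :=
  @Rep k Q (fun i => rep_dim X i + rep_dim Y i)%N
    (fun a => block_mx (rep_map X a) 0 0 (rep_map Y a)).

Definition graded_map X Y :=
  {dffun forall i : 'I_(nv Q), 'M[k]_(rep_dim X i, rep_dim Y i)}.

Definition rep_hom X Y : {set graded_map X Y} :=
  [set p : graded_map X Y | [forall a : arrow Q,
     rep_map X a *m p (tgt a) == p (src a) *m rep_map Y a]].

Definition rep_mono X Y (p : graded_map X Y) : bool := [forall i, row_free (p i)].
Definition rep_epi X Y (p : graded_map X Y) : bool := [forall i, row_full (p i)].

Definition rep_iso X Y : bool :=
  [exists p in rep_hom X Y, rep_mono p && rep_epi p].

Definition is_zero_rep X : Prop := forall i, rep_dim X i = 0%N.

Definition indecomposable X : Prop :=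
  ~ is_zero_rep X /\
  forall Y Z, rep_iso X (dsum_rep Y Z) -> is_zero_rep Y \/ is_zero_rep Z.

Definition rep_aut X : {set graded_map X X} :=
  [set p in rep_hom X X | rep_mono p && rep_epi p].

(* A submodule of Y is a family of subspaces U i, each given by its canonical
   generating matrix, that is stable under the maps of Y. *)
Definition is_submodule Y
    (U : {dffun forall i : 'I_(nv Q), 'M[k]_(rep_dim Y i)}) : bool :=
  [forall i, <<U i>>%MS == U i] &&
  [forall a : arrow Q, (U (src a) *m rep_map Y a <= U (tgt a))%MS].

Definition sub_rep Y (U : {dffun forall i : 'I_(nv Q), 'M[k]_(rep_dim Y i)}) :
    rep k Q :=
  @Rep k Q (fun i => \rank (U i))
    (fun a => in_submod (U (tgt a))
                (val_submod (U := U (src a)) 1%:M *m rep_map Y a)).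

Definition quo_rep Y (U : {dffun forall i : 'I_(nv Q), 'M[k]_(rep_dim Y i)}) :
    rep k Q :=
  @Rep k Q (fun i => \rank (cokermx (U i)))
    (fun a => in_factmod (U (tgt a))
                (val_factmod (U := U (src a)) 1%:M *m rep_map Y a)).

Definition hallF X Z Y : nat :=
  #|[set U | [&& @is_submodule Y U, rep_iso (sub_rep U) Z
               & rep_iso (quo_rep U) X]]|.

(* Ext^1(X, Z)_Y is the set of equivalence classes of short exact sequences
   0 -> Z -> Y -> X -> 0, where two sequences with middle term Y are equivalent
   when some automorphism of Y is compatible with the identities of Z and X. *)
Definition short_exact X Z Y : {set graded_map Z Y * graded_map Y X} :=
  [set s | [&& s.1 \in rep_hom Z Y, s.2 \in rep_hom Y X, rep_mono s.1,
     rep_epi s.2 & [forall i, (s.1 i == kermx (s.2 i))%MS]]].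

Definition ext_equiv X Z Y : rel (graded_map Z Y * graded_map Y X) :=
  fun s s' => [exists h in rep_aut Y, [forall i,
    (s.1 i *m h i == s'.1 i) && (h i *m s'.2 i == s.2 i)]].

Definition ext_classes X Z Y : {set {set graded_map Z Y * graded_map Y X}} :=
  equivalence_partition (@ext_equiv X Z Y) (short_exact X Z Y).

Definition hallG X Z Y : algC := #|ext_classes X Z Y|%:R / #|rep_hom X Z|%:R.

Definition hallA X : nat := #|rep_aut X|.

Definition sum_rep (M : posroots Q -> rep k Q) (l : partition_fun Q) : rep k Q :=
  \big[dsum_rep/zero_rep]_(b : posroots Q) iter (l b) (dsum_rep (M b)) zero_rep.

End Rep.

(* M k b is the representation M_q(b), where k is the field with q elements. *)
Definition rep_family (Q : dynkin_iquiver) :=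
  forall k : finFieldType, posroots Q -> rep k Q.

Definition is_indec_family Q (M : rep_family Q) : Prop :=
  forall (k : finFieldType) (b : posroots Q),
    indecomposable (M k b) /\ forall i, (rep_dim (M k b) i)%:Z = val b i.

(** ** Hall polynomials *)

(* Z[v, v^-1]: finitely supported families of integer coefficients indexed by
   the exponents. *)
Definition laurent := {malg int[int]}.

Definition laurent_eval (R : unitRingType) (p : laurent) (x : R) : R :=
  \sum_(i <- msupp p) (p@_i)%:~R * x ^ i.

Definition sqrt_card (k : finFieldType) : algC := sqrtC #|k|%:R.

(* f l m n and g l m n are the polynomials with lower indices l, m and upper
   index n. *)
Definition is_hallF_poly Q (M : rep_family Q)
    (f : partition_fun Q -> partition_fun Q -> partition_fun Q -> laurent) : Prop :=
  forall (k : finFieldType) l m n, laurent_eval (f l m n) (sqrt_card k) =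
    (hallF (sum_rep (M k) l) (sum_rep (M k) m) (sum_rep (M k) n))%:R.

Definition is_hallG_poly Q (M : rep_family Q)
    (g : partition_fun Q -> partition_fun Q -> partition_fun Q -> laurent) : Prop :=
  forall (k : finFieldType) l m n, laurent_eval (g l m n) (sqrt_card k) =
    hallG (sum_rep (M k) l) (sum_rep (M k) m) (sum_rep (M k) n).

Definition is_hallA_poly Q (M : rep_family Q)
    (a : partition_fun Q -> laurent) : Prop :=
  forall (k : finFieldType) l, laurent_eval (a l) (sqrt_card k) =
    (hallA (sum_rep (M k) l))%:R.

(** ** Algebras over Q(v^{1/2}) *)

Definition Qv := {fraction {poly rat}}.
Definition v_half : Qv := tofrac 'X.
Definition v : Qv := v_half ^+ 2.

Definition lin_ext (X : choiceType) (V : lmodType Qv) (b : X -> V)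
    (c : {malg Qv[X]}) : V :=
  \sum_(x <- msupp c) c@_x *: b x.

Definition bilin_ext (X Y : choiceType) (V : lmodType Qv) (b : X -> Y -> V)
    (c : {malg Qv[X]}) (d : {malg Qv[Y]}) : V :=
  lin_ext (fun x => lin_ext (b x) d) c.

Definition is_basis (X : choiceType) (V : lmodType Qv) (b : X -> V) : Prop :=
  bijective (lin_ext b).

Section Algebras.
Variable Q : dynkin_iquiver.
Local Notation L := (lattice Q).
Local Notation P := (partition_fun Q).
Variables (f g : P -> P -> P -> laurent) (a : P -> laurent).
Implicit Types (l m n : P) (x y : L).

Definition fv l m n : Qv := laurent_eval (f l m n) v.
Definition gv l m n : Qv := laurent_eval (g l m n) v.
Definition av l : Qv := laurent_eval (a l) v.

Definition zeroP : P := [ffun=> 0%N].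

(* In the sums over families of elements of P below only finitely many terms
   are nonzero, because f and g vanish unless the dimension vectors add up. *)

Definition iHall_exponent (l m th n ga de : P) : int :=
  euler (dimL de) (dimL th) - euler (rhoL (dimL de)) (dimL th)
  - euler (dimL l) (dimL m) + euler (dimL n) (dimL ga) *+ 2.

Record is_iHall_algebra (H : algType Qv) (K : L -> H) (u : P -> H) : Prop := {
  iHall_basis : is_basis (fun z : L * P => K z.1 * u z.2);
  iHall_K0 : K 0 = 1;
  iHall_u0 : u zeroP = 1;
  iHall_KK : forall x y, K x * K y = K (x + y);
  iHall_Ku : forall x l,
    K x * u l = v ^ (sym_euler (rhoL x) (dimL l) - sym_euler x (dimL l))
                *: (u l * K x);
  iHall_uu : forall l m,
    u l * u m =
    \sum_(z \in [set: P * P * P * P])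
      let: (th, n, ga, de) := z in
      (v ^ iHall_exponent l m th n ga de * av de * fv de n l
         * fv ga (rhoP de) m * gv n ga th) *: (K (dimL de) * u th) }.

(* The extended Hall algebra B(Q): the generator indexed by (l, x) is
   u_l . K_x.  Its tensor square has the pairs of generators as a basis. *)
Definition Bindex : choiceType := (P * L)%type.
Definition extHall := {malg Qv[Bindex]}.
Definition extHall2 := {malg Qv[(Bindex * Bindex)%type]}.

Definition uK l x : extHall := << ((l, x) : Bindex) >>.

(* Bilinear extension of the product of u_l . K_x and u_m . K_y, which is
   v^{(x, m)} (u_l . u_m) . K_{x + y}. *)
Definition B_mul : extHall -> extHall -> extHall :=
  bilin_ext (fun s t : Bindex =>
    \sum_(n \in [set: P])
      (v ^ (sym_euler s.2 (dimL t.1) + euler (dimL s.1) (dimL t.1))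
         * gv s.1 t.1 n) *: uK n (s.2 + t.2)).

(* Linear extension of Delta(u_l . K_x) = Delta(u_l) . (K_x (x) K_x). *)
Definition B_coprod : extHall -> extHall2 :=
  lin_ext (fun s : Bindex =>
    \sum_(z \in [set: P * P])
      (v ^ euler (dimL z.1) (dimL z.2) * fv z.1 z.2 s.1) *:
        (<< ((z.1, dimL z.2 + s.2), (z.2, s.2)) >> : extHall2)).

Definition B_pairing : extHall -> extHall -> Qv^o :=
  bilin_ext (fun s t : Bindex =>
    (v ^ sym_euler s.2 t.2 * (s.1 == t.1)%:R * av s.1 : Qv^o)).

Definition B_rho : extHall -> extHall :=
  lin_ext (fun s : Bindex => uK (rhoP s.1) (rhoL s.2)).

(* In Sweedler notation, with s = c_(1) (x) c_(2) and t = d_(1) (x) d_(2):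
   c * d = sum phi (rho d_(2), c_(1)) c_(2) . d_(1). *)
Definition iHopf_mul (c d : extHall) : extHall :=
  bilin_ext (fun s t : Bindex * Bindex =>
    (B_pairing (B_rho << t.2 >>) << s.1 >> : Qv) *: B_mul << s.2 >> << t.1 >>)
    (B_coprod c) (B_coprod d).

Definition iHopf_one : extHall := uK zeroP 0.

End Algebras.

(* Main.v *)
Require Import Defs.
From HB Require Import structures.
From mathcomp Require Import all_boot all_order all_algebra all_field.
From mathcomp Require Import finmap.
From mathcomp Require Import classical_sets fsbigop.
From mathcomp Require Import monalg.
From mathcomp Require Import zify ring.

Set Implicit Arguments.
Unset Strict Implicit.
Unset Printing Implicit Defensive.

Import Order.TTheory GRing.Theory Num.Theory.
Local Open Scope ring_scope.

(** Both multiplications are given on explicit bases, so the linear map that is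
    prescribed on the basis u_l * K_x can be compared with them coefficient by
    coefficient.  Expanding the coproducts of u_l . K_x and u_m . K_y in the
    iHopf product gives a sum over all decompositions of l into (de, n) and of m
    into (ga, m2).  The Hopf pairing kills every term except those in which m2
    is the image of de under the involution, and it contributes the factor a_de.
    The remaining product u_n . u_ga is a sum over th.  Hence both products are
    sums over the same quadruples (de, n, ga, th), with the same Hall numbers
    a_de f^l_{de,n} f^m_{ga,rho de} g^th_{n,ga}, and differ only in their powers
    of v.

    The exponents of v agree ([exponentE]) under the relations
      d^l = d^de + d^n,  d^m = d^ga + rho d^de,  d^th = d^n + d^ga,
    by bilinearity and rho-invariance of the Euler form.  The structure
    constants do vanish unless these relations hold ([fv_dim], [gv_dim]): over
    each finite field a submodule, or an extension, forces the dimension vectors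
    to add up, so a Hall polynomial violating the relation has the value 0 at
    the square root of every prime power, and a Laurent polynomial with
    infinitely many zeros is 0 ([laurent_eq0]).

    The same grading makes all sums finite.  Positive roots are nonzero because
    they are dimension vectors of indecomposable representations, so only
    finitely many partition functions have height at most N.  The sums over all
    partition functions can therefore be written as sums over one finite list,
    [box Q N], where N is a bound for the height of l plus that of m.

    Finally the map is bijective since it sends a basis to nonzero multiples of
    the elements of a basis. *)

(** * Laurent polynomials vanishing at all prime powers *)

(** A Laurent polynomial becomes a polynomial after multiplication by a power of
    the variable, and the fields of cardinality 2 ^ k alone already provide
    infinitely many zeros. *)
Lemma laurent_eq0 (p : laurent) :
  (forall k : finFieldType, laurent_eval p (sqrt_card k) = 0) -> p = 0.
Proof.
move=> p0.
(* Multiplication by the N-th power of the variable removes the negative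
   exponents. *)
pose N : nat := \sum_(i <- msupp p) absz i.
have shift_ge0 i : i \in msupp p -> 0 <= i + N%:Z.
  move=> pi; have : (absz i <= N)%N by rewrite /N (big_fsetD1 i) //= leq_addr.
  by lia.
pose r : {poly algC} :=
  \sum_(i <- msupp p) (p@_i)%:~R *: 'X^(absz (i + N%:Z)).
have r_root (k : finFieldType) : root r (sqrt_card k).
  have k0 : sqrt_card k != 0.
    rewrite sqrtC_eq0 pnatr_eq0 -lt0n; apply/card_gt0P; by exists 0.
  have -> : (root r (sqrt_card k)) =
    ((sqrt_card k) ^ N%:Z * laurent_eval p (sqrt_card k) == 0).
    rewrite /root /r horner_sum /laurent_eval mulr_sumr; congr (_ == 0).
    apply: eq_big_seq => i pi; rewrite hornerZ hornerXn mulrCA -expfzDr //.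
    by rewrite exprnP gez0_abs ?shift_ge0 // addrC.
  by rewrite p0 mulr0.
have r0 : r = 0.
  apply/eqP/negPn/negP => rN0.
  pose x e : algC := sqrtC (2 ^ e.+1)%:R.
  have := max_poly_roots (rs := [seq x e | e <- iota 0 (size r)]) rN0.
  rewrite size_map size_iota ltnn => bad; apply: notF; apply: bad.
    apply/allP => _ /mapP[e _ ->].
    have [k _ kE] := pPrimePowerField (isT : prime 2) (ltn0Sn e).
    by rewrite /x -kE; exact: r_root.
  rewrite map_inj_uniq ?iota_uniq // => e e' /(congr1 (fun z => z ^+ 2)).
  by rewrite !sqrtCK => /eqP; rewrite Num.Theory.eqr_nat eqn_exp2l // => /eqP[].
apply/malgP => i; rewrite mcoeff0; apply/eqP/negPn; rewrite mcoeff_neq0.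
apply/negP => pi; have := congr1 (fun s : {poly algC} => s`_(absz (i + N%:Z))) r0.
rewrite /r coef_sum coef0 (big_fsetD1 i) //= coefZ coefXn eqxx mulr1.
rewrite big1_seq => [/eqP|j /andP[_]].
  by rewrite addr0 intr_eq0 mcoeff_eq0 pi.
rewrite in_fsetD1 => /andP[ji pj]; rewrite coefZ coefXn.
have := shift_ge0 i pi; have := shift_ge0 j pj.
by case: eqP => [|_]; [lia | rewrite mulr0].
Qed.

Lemma laurent_eval0 (R : unitRingType) (x : R) : laurent_eval 0 x = 0.
Proof. by rewrite /laurent_eval msupp0 big_seq_fset0. Qed.

(** * Additivity of dimension vectors *)

Section DimensionVectors.
Variables (k : finFieldType) (Q : dynkin_iquiver).
Implicit Types X Y Z : rep k Q.

Lemma rep_iso_dim X Y i : rep_iso X Y -> rep_dim X i = rep_dim Y i.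
Proof.
case/existsP=> p /and3P[_ /forallP/(_ i)/eqP row_p /forallP/(_ i)/eqP].
exact: etrans.
Qed.

Lemma hallF_dim X Z Y :
  hallF X Z Y != 0%N -> forall i, rep_dim Y i = (rep_dim X i + rep_dim Z i)%N.
Proof.
rewrite cards_eq0 => /set0Pn[U]; rewrite inE => /and3P[_ UZ UX] i.
rewrite -(rep_iso_dim i UZ) -(rep_iso_dim i UX) /= mxrank_coker subnK //.
exact: rank_leq_row.
Qed.

Lemma short_exact_dim X Z Y s :
  s \in short_exact X Z Y ->
  forall i, rep_dim Y i = (rep_dim X i + rep_dim Z i)%N.
Proof.
rewrite inE => /and5P[_ _ /forallP mono_s /forallP epi_s /forallP ex_s] i.
have /eqP <- := mono_s i; have /eqP <- := epi_s i.
by rewrite (eqmx_rank (ex_s i)) mxrank_ker subnKC // rank_leq_row.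
Qed.

Lemma hallG_dim X Z Y :
  hallG X Z Y != 0 -> forall i, rep_dim Y i = (rep_dim X i + rep_dim Z i)%N.
Proof.
move=> G_neq0 i; case: (set_0Vmem (short_exact X Z Y)) => [ex0|[s]]; last first.
  by move/short_exact_dim.
case/negP: G_neq0; rewrite /hallG /ext_classes ex0 /equivalence_partition.
by rewrite imset0 cards0 mul0r.
Qed.

Lemma sum_rep_dim (M : posroots Q -> rep k Q) l i :
  rep_dim (sum_rep M l) i = (\sum_b l b * rep_dim (M b) i)%N.
Proof.
rewrite /sum_rep (big_morph (fun X => rep_dim X i) (id1 := 0%N) (op1 := addn)) //.
by apply: eq_bigr => b _; elim: (l b) => //= n ->; rewrite mulSn.
Qed.

End DimensionVectors.

(** * The Euler form, the involution and bounded partition functions *)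

Section PartitionFunctions.
Variable Q : dynkin_iquiver.
Local Notation L := (lattice Q).
Local Notation P := (partition_fun Q).
Implicit Types (x y z : L) (l m n : P).

Lemma dimLE l i : dimL l i = \sum_(b : posroots Q) val b i *+ l b.
Proof. by rewrite /dimL sum_ffunE; apply: eq_bigr => b _; rewrite ffunMnE. Qed.

Lemma rho_rootK : involutive (@rho_root Q).
Proof. by move=> b; apply: val_inj; rewrite /= rhoLK. Qed.

Lemma rhoPK : involutive (@rhoP Q).
Proof. by move=> l; apply/ffunP => b; rewrite !ffunE rho_rootK. Qed.

Lemma dimL_rhoP l : dimL (rhoP l) = rhoL (dimL l).
Proof.
apply/ffunP => i; rewrite [RHS]ffunE !dimLE.
rewrite (reindex_inj (inv_inj rho_rootK)); apply: eq_bigr => b _.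
by rewrite /= !ffunE rho_rootK.
Qed.

Lemma dimL_zeroP : dimL (zeroP Q) = 0.
Proof. by rewrite /dimL big1 // => b _; rewrite ffunE. Qed.

Lemma rhoLD x y : rhoL (x + y) = rhoL x + rhoL y.
Proof. by apply/ffunP => i; rewrite !ffunE. Qed.

Lemma rhoL0 : rhoL (0 : L) = 0.
Proof. by apply/ffunP => i; rewrite !ffunE. Qed.

Lemma eulerDl x y z : euler (x + y) z = euler x z + euler y z.
Proof.
rewrite /euler addrACA -opprD -!big_split /=.
by congr (_ - _); apply: eq_bigr => i _; rewrite !ffunE mulrDl.
Qed.

Lemma eulerDr x y z : euler x (y + z) = euler x y + euler x z.
Proof.
rewrite /euler addrACA -opprD -!big_split /=.
by congr (_ - _); apply: eq_bigr => i _; rewrite !ffunE mulrDr.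
Qed.

Lemma euler0 x : euler 0 x = 0.
Proof. by rewrite /euler !big1 ?subr0 // => *; rewrite ffunE mul0r. Qed.

Lemma euler_rhoLl x y : euler (rhoL x) y = euler x (rhoL y).
Proof. by rewrite -(euler_rhoL x) rhoLK. Qed.

(** Listing the partition functions with bounded values turns the sums over all
    of them into ordinary iterated sums. *)
Definition box N : seq P :=
  undup [seq [ffun b => nat_of_ord (h b)] | h : {ffun posroots Q -> 'I_N.+1}].

Lemma mem_box N l : (l \in box N) = [forall b, l b <= N]%N.
Proof.
rewrite mem_undup; apply/mapP/forallP => [[h _ ->] b|lN].
  by rewrite ffunE -ltnS.
exists [ffun b => inord (l b)]; first exact: mem_enum.
by apply/ffunP => b; rewrite !ffunE inordK // ltnS.
Qed.

Lemma mem_box_rhoP N l : (rhoP l \in box N) = (l \in box N).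
Proof.
rewrite !mem_box; apply/forallP/forallP => lN b; last by rewrite ffunE.
by have := lN (rho_root b); rewrite ffunE rho_rootK.
Qed.

End PartitionFunctions.

(** * Grading of the Hall polynomials *)

Section IndecomposableFamily.
Variables (Q : dynkin_iquiver) (M : rep_family Q).
Hypothesis hM : is_indec_family M.
Local Notation P := (partition_fun Q).
Implicit Types (l m n : P).

Lemma sum_rep_dimL k l i : (rep_dim (sum_rep (M k) l) i)%:Z = dimL l i.
Proof.
rewrite sum_rep_dim dimLE (big_morph Posz PoszD (erefl 0%:Z)).
by apply: eq_bigr => b _; rewrite PoszM (hM k b).2 mulrC -mulr_natr natz.
Qed.

(** The root b is the dimension vector of an indecomposable representation, and
    such a representation is nonzero. *)
Lemma posroot_height b : 1 <= \sum_i val (b : posroots Q) i.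
Proof.
have [[b_neq0 _] bE] := hM 'F_2 b.
have b_ge0 i : 0 <= val b i by rewrite -bE.
have [i bi] : exists i, rep_dim (M 'F_2 b) i != 0%N.
  apply/existsP; apply: contraPT b_neq0 => /existsPn b0; apply=> i.
  by apply/eqP; have := b0 i; rewrite negbK.
rewrite (bigD1 i) //= -[1]addr0 lerD ?sumr_ge0 //.
by rewrite -bE lez_nat lt0n.
Qed.

Lemma dimL_ge0 l i : 0 <= dimL l i.
Proof. by rewrite -(sum_rep_dimL 'F_2). Qed.

(** Each summand of M(l) adds at least 1 to the total dimension, so a bound on
    the total dimension bounds every multiplicity. *)
Lemma mem_box_height l (N : nat) : \sum_i dimL l i <= N%:Z -> l \in box Q N.
Proof.
move=> lN; rewrite mem_box; apply/forallP => b; rewrite -lez_nat.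
apply: le_trans lN.
have -> : \sum_i dimL l i = \sum_b (\sum_i val (b : posroots Q) i) *+ l b.
  under eq_bigr do rewrite dimLE.
  by rewrite exchange_big; apply: eq_bigr => c _; rewrite sumrMnl.
rewrite (bigD1 b) //= -[(_%:Z)]addr0 lerD //.
  by rewrite -[_%:Z]natz lerMn2r posroot_height orbT.
by apply: sumr_ge0 => c _; rewrite mulrn_wge0 // (le_trans _ (posroot_height c)).
Qed.

Variables (f g : P -> P -> P -> laurent).
Hypotheses (hf : is_hallF_poly M f) (hg : is_hallG_poly M g).

(** The polynomial f^n_{l,m} is 0 as soon as the dimension vectors do not add up,
    since all the numbers it interpolates are then 0. *)
Lemma fv_dim l m n : fv f l m n != 0 -> dimL n = dimL l + dimL m.
Proof.
apply: contraNeq => nE; apply/eqP; rewrite /fv.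
suff -> : f l m n = 0 by rewrite laurent_eval0.
apply: laurent_eq0 => k; rewrite hf; apply/eqP; rewrite pnatr_eq0.
apply: contraNT nE => /hallF_dim nE; apply/eqP/ffunP => i.
by rewrite ffunE -!(sum_rep_dimL k) nE.
Qed.

Lemma gv_dim l m n : gv g l m n != 0 -> dimL n = dimL l + dimL m.
Proof.
apply: contraNeq => nE; apply/eqP; rewrite /gv.
suff -> : g l m n = 0 by rewrite laurent_eval0.
apply: laurent_eq0 => k; rewrite hg; apply/eqP.
apply: contraNT nE => /hallG_dim nE; apply/eqP/ffunP => i.
by rewrite ffunE -!(sum_rep_dimL k) nE.
Qed.

End IndecomposableFamily.

(** * Linear and bilinear extensions *)

Section LinearExtension.
Variables (X : choiceType) (V : lmodType Qv).

Lemma lin_extE (b : X -> V) (c : {malg Qv[X]}) (D : {fset X}) :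
  (msupp c `<=` D)%fset -> lin_ext b c = \sum_(x <- D) c@_x *: b x.
Proof.
move=> cD; rewrite /lin_ext (big_fset_incl _ cD) // => x _ /mcoeff_outdom ->.
by rewrite scale0r.
Qed.

Fact lin_ext_is_linear (b : X -> V) : linear (lin_ext b).
Proof.
move=> t c d; pose D := (msupp c `|` msupp d `|` msupp (t *: c + d))%fset.
have cD : (msupp c `<=` D)%fset by rewrite /D -fsetUA fsubsetUl.
have dD : (msupp d `<=` D)%fset by rewrite /D fsetUAC fsubsetUr.
rewrite (lin_extE b cD) (lin_extE b dD) (@lin_extE b _ D) ?fsubsetUr //.
rewrite scaler_sumr -big_split /=; apply: eq_bigr => x _.
by rewrite mcoeffD mcoeffZ scalerDl scalerA.
Qed.

HB.instance Definition _ b :=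
  GRing.isLinear.Build Qv {malg Qv[X]} V _ (lin_ext b) (lin_ext_is_linear b).

Lemma lin_ext_sum (b : X -> V) (I : Type) (r : seq I) (t : I -> Qv)
    (c : I -> {malg Qv[X]}) :
  lin_ext b (\sum_(i <- r) t i *: c i) = \sum_(i <- r) t i *: lin_ext b (c i).
Proof. by rewrite linear_sum; apply: eq_bigr => i _; rewrite linearZ. Qed.

Lemma lin_extZ (b : X -> V) (t : Qv) (c : {malg Qv[X]}) :
  lin_ext b (t *: c) = t *: lin_ext b c.
Proof. exact: linearZ. Qed.

Lemma lin_ext_basis (b : X -> V) x : lin_ext b << x >> = b x.
Proof. by rewrite /lin_ext msuppU oner_eq0 big_seq_fset1 mcoeffUU scale1r. Qed.

Lemma malg_sum (c : {malg Qv[X]}) : c = \sum_(x <- msupp c) c@_x *: << x >>.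
Proof.
rewrite [LHS]monalgE; apply: eq_bigr => x _; apply/malgP => y.
by rewrite mcoeffZ !mcoeffU mulr_natr.
Qed.

End LinearExtension.

Section BilinearExtension.
Variables (X Y : choiceType) (V : lmodType Qv).

Lemma bilin_ext_suml (b : X -> Y -> V) (I : Type) (r : seq I) (c : I -> Qv)
    (x : I -> {malg Qv[X]}) (y : {malg Qv[Y]}) :
  bilin_ext b (\sum_(i <- r) c i *: x i) y =
  \sum_(i <- r) c i *: bilin_ext b (x i) y.
Proof. exact: lin_ext_sum. Qed.

Lemma bilin_ext_sumr (b : X -> Y -> V) (J : Type) (s : seq J) (d : J -> Qv)
    (x : {malg Qv[X]}) (y : J -> {malg Qv[Y]}) :
  bilin_ext b x (\sum_(j <- s) d j *: y j) =
  \sum_(j <- s) d j *: bilin_ext b x (y j).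
Proof.
rewrite /bilin_ext !(lin_extE _ (fsubset_refl (msupp x))).
under eq_bigr do rewrite lin_ext_sum scaler_sumr.
rewrite exchange_big; apply: eq_bigr => j _.
rewrite !(lin_extE _ (fsubset_refl (msupp x))) scaler_sumr.
by apply: eq_bigr => z _; rewrite !scalerA mulrC.
Qed.

Lemma bilin_ext_basis (b : X -> Y -> V) x y :
  bilin_ext b << x >> << y >> = b x y.
Proof. by rewrite /bilin_ext !lin_ext_basis. Qed.

End BilinearExtension.

(** * Linear maps given on a basis *)

Section Bases.
Variables (X : choiceType) (V W : lmodType Qv) (b : X -> V).
Hypothesis hb : is_basis b.

Lemma basis_span (x : V) : exists c : {malg Qv[X]}, x = lin_ext b c.
Proof. by have [h _ hK] := hb; exists (h x); rewrite hK. Qed.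

Lemma basis_linear (w : X -> W) :
  exists F : {linear V -> W}, forall x, F (b x) = w x.
Proof.
have [h bK hK] := hb.
have h_linear : linear h := can2_linear bK hK.
pose hL := GRing.isLinear.Build Qv V {malg Qv[X]} _ h h_linear.
pose h' : {linear V -> {malg Qv[X]}} := HB.pack h hL.
exists (lin_ext w \o h') => x /=.
by rewrite -(lin_ext_basis b) bK lin_ext_basis.
Qed.

End Bases.

(** * Sums of finite support over bounded lists *)

Lemma big_seq_single (V : nmodType) (I : eqType) (r : seq I) (i : I) (F : I -> V) :
    uniq r -> i \in r -> (forall j, j != i -> F j = 0) ->
  \sum_(j <- r) F j = F i.
Proof. by move=> r_uniq ri F0; rewrite (bigD1_seq i) //= big1 ?addr0. Qed.

Section BoundedSums.
Variable V : nmodType.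

Definition square (T : Type) (r : seq T) : seq (T * T) :=
  [seq (t, w) | t <- r, w <- r].

Lemma fsbig_seqT (T : choiceType) (r : seq T) (F : T -> V) :
    uniq r -> (forall z, F z != 0 -> z \in r) ->
  \sum_(z \in [set: T]) F z = \sum_(z <- r) F z.
Proof.
move=> r_uniq F0; rewrite (fsbigE r) //; first by under eq_bigl do rewrite in_setT.
by move=> z _; apply: contraNeq; apply: F0.
Qed.

Lemma square_uniq (T : eqType) (r : seq T) : uniq r -> uniq (square r).
Proof. by move=> r_uniq; apply: allpairs_uniq => // -[? ?] [? ?]. Qed.

Lemma mem_square (T : eqType) (r : seq T) t w :
  ((t, w) \in square r) = (t \in r) && (w \in r).
Proof.
apply/allpairsP/andP => [[[t' w'] [/= tr wr [-> ->]]] // | [tr wr]].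
by exists (t, w).
Qed.

Lemma fsbig_quad (T : choiceType) (r : seq T) (F : T * T * T * T -> V) :
    uniq r ->
    (forall t w x y, F (t, w, x, y) != 0 ->
      [/\ t \in r, w \in r, x \in r & y \in r]) ->
  \sum_(z \in [set: T * T * T * T]) F z =
  \sum_(t <- r) \sum_(w <- r) \sum_(x <- r) \sum_(y <- r) F (t, w, x, y).
Proof.
move=> r_uniq F0.
rewrite (fsbig_seqT (r := [seq (t, w) | t <- [seq (t, w) | t <- square r, w <- r],
  w <- r])); first by rewrite /square !big_allpairs.
  do 2![apply: allpairs_uniq => //; last by move=> [? ?] [? ?]].
  exact: square_uniq.
move=> [[[t w] x] y] /F0[tr wr xr yr].
apply/allpairsP; exists ((t, w, x), y); split=> //=.
apply/allpairsP; exists ((t, w), x); split=> //=.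
by rewrite mem_square tr wr.
Qed.

End BoundedSums.

(** * Comparison of the powers of v *)

Lemma v_neq0 : v != 0.
Proof. by rewrite /v expf_neq0 // /v_half tofrac_eq0 polyX_eq0. Qed.

Lemma eq_scale_uK (Q : dynkin_iquiver) (c d : Qv) l (x y : lattice Q) :
  c = d -> x = y -> c *: uK l x = d *: uK l y.
Proof. by move=> -> ->. Qed.

(** The coefficients are rearranged over an abstract field, so that no conversion
    problem unfolds the arithmetic of fractions of polynomials. *)
Section Coefficients.
Variables (F : fieldType) (w : F).
Hypothesis w_neq0 : w != 0.

Lemma iHopf_coefE (e1 e2 e3 e4 : int) (c1 c2 c3 c4 : F) :
  w ^ e1 * c1 * (w ^ e2 * c2) * (w ^ e3 * c3) * (w ^ e4 * c4) =
  w ^ (e1 + e2 + e3 + e4) * (c3 * c1 * c2 * c4).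
Proof. by rewrite !expfzDr //; ring. Qed.

Lemma Phi_coefE (e1 e2 e3 e4 e5 e6 e7 : int) (c : F) :
  e1 + e2 + e3 + e4 = e5 + e6 + e7 ->
  w ^ e2 * c * w ^ e3 * w ^ e1 * w ^ e4 = w ^ e7 * c * (w ^ e5 * w ^ e6).
Proof.
move=> eE; have := congr1 (fun e => w ^ e) eE; rewrite !expfzDr // => wE.
transitivity (w ^ e1 * w ^ e2 * w ^ e3 * w ^ e4 * c); first by ring.
by rewrite wE; ring.
Qed.

End Coefficients.

Section Exponents.
Variable Q : dynkin_iquiver.
Implicit Types x y : lattice Q.

(** The heart of the matter.  The left-hand side collects the exponents obtained
    by moving K_x past u_m, from the iHall product of u_l and u_m, by moving
    K_de past u_th, and from the map itself at u_th * K_{de+x+y}.  The right-hand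
    side collects those from the map at u_l * K_x and at u_m * K_y and from the
    iHopf product.  Here de, n, ga stand for the dimension vectors of the
    corresponding partition functions; those of l, m and th are eliminated by
    the additivity relations. *)
Lemma exponentE x y de n ga :
  sym_euler (rhoL x) (ga + rhoL de) - sym_euler x (ga + rhoL de)
  + (euler de (n + ga) - euler (rhoL de) (n + ga)
     - euler (de + n) (ga + rhoL de) + euler n ga *+ 2)
  + (sym_euler (rhoL de) (n + ga) - sym_euler de (n + ga))
  + (sym_euler (n + ga) (de + (x + y))
     + euler (de + (x + y)) (rhoL (de + (x + y))))
  = (sym_euler (de + n) x + euler x (rhoL x))
    + (sym_euler (ga + rhoL de) y + euler y (rhoL y))
    + (euler de n + euler ga (rhoL de)
       + sym_euler (rhoL (rhoL y)) (n + rhoL x)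
       + (sym_euler (rhoL x) ga + euler n ga)).
Proof.
rewrite /sym_euler !(rhoLD, rhoLK) !(eulerDl, eulerDr).
(* Moving every rho to the second argument leaves independent atoms. *)
rewrite !(euler_rhoL, euler_rhoLl, rhoLK) mulr2n; ring.
Qed.

End Exponents.

(** * The two products in terms of Hall numbers *)

Section Products.
Variables (Q : dynkin_iquiver) (M : rep_family Q).
Hypothesis hM : is_indec_family M.
Local Notation L := (lattice Q).
Local Notation P := (partition_fun Q).
Variables (f g : P -> P -> P -> laurent) (a : P -> laurent).
Hypotheses (hf : is_hallF_poly M f) (hg : is_hallG_poly M g).
Implicit Types (x y : L) (l m n : P) (N : nat).

(** The height is additive along nonzero Hall polynomials, and only finitely many
    partition functions lie below each bound; this makes all sums finite. *)
Definition height l : int := \sum_i dimL l i.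

Lemma height_ge0 l : 0 <= height l.
Proof. by apply: sumr_ge0 => i _; apply: dimL_ge0 hM _ _. Qed.

Lemma heightD l m n : dimL n = dimL l + dimL m -> height n = height l + height m.
Proof.
by move=> nE; rewrite -big_split; apply: eq_bigr => i _; rewrite nE ffunE.
Qed.

Lemma height_rhoP l : height (rhoP l) = height l.
Proof.
rewrite /height dimL_rhoP [RHS](reindex_inj (inv_inj (@rhoVK Q))).
by apply: eq_bigr => i _; rewrite ffunE.
Qed.

Lemma box_height N l : height l <= N%:Z -> l \in box Q N.
Proof. exact: (mem_box_height hM). Qed.

Lemma box_uniq N : uniq (box Q N).
Proof. exact: undup_uniq. Qed.

Lemma B_coprodE N l x : height l <= N%:Z ->
  B_coprod f << ((l, x) : Bindex Q) >> =
  \sum_(z <- square (box Q N))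
    (v ^ euler (dimL z.1) (dimL z.2) * fv f z.1 z.2 l) *:
      (<< ((z.1, dimL z.2 + x), (z.2, x)) >> : extHall2 Q).
Proof.
move=> lN; rewrite /B_coprod lin_ext_basis; apply: fsbig_seqT.
  exact/square_uniq/box_uniq.
move=> [m n] /=; have [->|/(fv_dim hM hf)/heightD lE] := eqVneq (fv f m n l) 0.
  by rewrite mulr0 scale0r eqxx.
have m_ge0 := height_ge0 m; have n_ge0 := height_ge0 n => _.
by rewrite mem_square !box_height //; lia.
Qed.

Lemma B_mulE N l x m y : height l + height m <= N%:Z ->
  B_mul g << ((l, x) : Bindex Q) >> << ((m, y) : Bindex Q) >> =
  \sum_(n <- box Q N)
    (v ^ (sym_euler x (dimL m) + euler (dimL l) (dimL m)) * gv g l m n)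
    *: uK n (x + y).
Proof.
move=> lmN; rewrite /B_mul bilin_ext_basis; apply: fsbig_seqT.
  exact: box_uniq.
move=> n /=; have [->|/(gv_dim hM hg)/heightD nE] := eqVneq (gv g l m n) 0.
  by rewrite mulr0 scale0r eqxx.
by move=> _; rewrite box_height // nE.
Qed.

Lemma B_pairing_rho l x m y :
  B_pairing a (B_rho << ((l, x) : Bindex Q) >>) << ((m, y) : Bindex Q) >> =
  v ^ sym_euler (rhoL x) y * (rhoP l == m)%:R * av a (rhoP l).
Proof. by rewrite /B_rho lin_ext_basis /B_pairing bilin_ext_basis. Qed.

(** The sum has no index for the second part of the decomposition of m, because
    the Hopf pairing forces it to be the image of de under the involution. *)
Lemma iHopf_mulE N l x m y : height l + height m <= N%:Z ->
  iHopf_mul f g a (uK l x) (uK m y) =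
  \sum_(de <- box Q N) \sum_(n <- box Q N) \sum_(ga <- box Q N)
  \sum_(th <- box Q N)
    (v ^ (euler (dimL de) (dimL n) + euler (dimL ga) (rhoL (dimL de))
          + sym_euler (rhoL y) (dimL n + x)
          + (sym_euler x (dimL ga) + euler (dimL n) (dimL ga)))
     * (av a de * fv f de n l * fv f ga (rhoP de) m * gv g n ga th))
    *: uK th (rhoL (dimL de) + (x + y)).
Proof.
move=> lmN; have l_ge0 := height_ge0 l; have m_ge0 := height_ge0 m.
rewrite /iHopf_mul (@B_coprodE N l) ?(@B_coprodE N m); try lia.
rewrite bilin_ext_suml /square big_allpairs; apply: eq_big_seq => de deN.
apply: eq_bigr => n _; rewrite bilin_ext_sumr -/(square _) scaler_sumr big_allpairs.
apply: eq_bigr => ga _.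
(* Only m2 = rho de pairs nontrivially with de. *)
apply: etrans.
  apply: (big_seq_single (i := rhoP de)); rewrite ?box_uniq ?mem_box_rhoP //.
  move=> m2 m2E; rewrite bilin_ext_basis /= B_pairing_rho.
  by rewrite (inv_eq (@rhoPK Q)) (negPf m2E) mulr0 mul0r scale0r !scaler0.
rewrite bilin_ext_basis /= B_pairing_rho rhoPK eqxx mulr1 !scalerA dimL_rhoP.
(* The bound on the height of n and ga, needed to expand their product over the
   list, is available only for nonzero coefficients. *)
have [->|lE] := eqVneq (fv f de n l) 0.
  rewrite !(mulr0, mul0r) scale0r big1 // => th _.
  by rewrite !(mulr0, mul0r) scale0r.
have [->|mE] := eqVneq (fv f ga (rhoP de) m) 0.
  rewrite !(mulr0, mul0r) scale0r big1 // => th _.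
  by rewrite !(mulr0, mul0r) scale0r.
have {}lE := heightD (fv_dim hM hf lE); have {}mE := heightD (fv_dim hM hf mE).
have de_ge0 := height_ge0 de; have rho_de_ge0 := height_ge0 (rhoP de).
rewrite (@B_mulE N); last by lia.
rewrite scaler_sumr; apply: eq_bigr => th _; rewrite scalerA; apply: eq_scale_uK.
  exact: iHopf_coefE v_neq0 _ _ _ _ _ _ _ _.
by rewrite addrCA.
Qed.

Lemma iHopf_mul_sum (I J : Type) (r : seq I) (s : seq J) (c : I -> Qv)
    (d : J -> Qv) (e : I -> extHall Q) (e' : J -> extHall Q) :
  iHopf_mul f g a (\sum_(i <- r) c i *: e i) (\sum_(j <- s) d j *: e' j) =
  \sum_(i <- r) \sum_(j <- s) (c i * d j) *: iHopf_mul f g a (e i) (e' j).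
Proof.
rewrite /iHopf_mul /B_coprod !lin_ext_sum bilin_ext_suml.
apply: eq_bigr => i _; rewrite bilin_ext_sumr scaler_sumr.
by apply: eq_bigr => j _; rewrite scalerA.
Qed.

Variables (H : algType Qv) (K : L -> H) (u : P -> H).
Hypothesis hH : is_iHall_algebra f g a K u.

Lemma iHall_uuE N l m : height l + height m <= N%:Z ->
  u l * u m =
  \sum_(de <- box Q N) \sum_(n <- box Q N) \sum_(ga <- box Q N)
  \sum_(th <- box Q N)
    (v ^ iHall_exponent l m th n ga de
     * (av a de * fv f de n l * fv f ga (rhoP de) m * gv g n ga th))
    *: (K (dimL de) * u th).
Proof.
move=> lmN; rewrite (iHall_uu hH).
rewrite (fsbig_quad (box_uniq N)) => [|th n ga de]; last first.
  have [->|/(fv_dim hM hf)/heightD lE] := eqVneq (fv f de n l) 0.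
    by rewrite !(mulr0, mul0r) scale0r eqxx.
  have [->|/(fv_dim hM hf)/heightD mE] := eqVneq (fv f ga (rhoP de) m) 0.
    by rewrite !(mulr0, mul0r) scale0r eqxx.
  have [->|/(gv_dim hM hg)/heightD thE _] := eqVneq (gv g n ga th) 0.
    by rewrite !(mulr0, mul0r) scale0r eqxx.
  have := height_ge0 n; have := height_ge0 ga; have := height_ge0 de.
  by move: mE; rewrite height_rhoP => mE *; split; apply: box_height; lia.
under eq_bigr => th _.
  under eq_bigr => n _ do rewrite exchange_big.
  rewrite exchange_big; over.
rewrite exchange_big; apply: eq_bigr => de _.
rewrite exchange_big; apply: eq_bigr => n _.
rewrite exchange_big; apply: eq_bigr => ga _.
by apply: eq_bigr => th _; rewrite !mulrA.
Qed.

(** * The isomorphism *)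

Definition Phi_exponent l x : int := sym_euler (dimL l) x + euler x (rhoL x).

(** After both products are expanded over the same quadruples, the terms with a
    vanishing Hall number are discarded, and for the others the additivity
    relations reduce the claim to the identity of exponents. *)
Lemma Phi_mul_basis (Phi : {linear H -> extHall Q}) :
    (forall l x, Phi (u l * K x) = v ^ Phi_exponent l x *: uK l (rhoL x)) ->
  forall l x m y, Phi ((u l * K x) * (u m * K y)) =
    (v ^ Phi_exponent l x * v ^ Phi_exponent m y) *:
    iHopf_mul f g a (uK l (rhoL x)) (uK m (rhoL y)).
Proof.
move=> PhiE l x m y.
have [N lmN] : exists N : nat, height l + height m <= N%:Z.
  by exists (absz (height l + height m)); lia.
rewrite (iHopf_mulE _ _ lmN).
have -> : (u l * K x) * (u m * K y) =
  v ^ (sym_euler (rhoL x) (dimL m) - sym_euler x (dimL m)) *: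
  (u l * u m * K (x + y)).
  rewrite mulrA -[u l * _ * _]mulrA (iHall_Ku hH) -scalerAr -scalerAl mulrA.
  by rewrite -[_ * K x * _]mulrA (iHall_KK hH).
rewrite linearZ /= (iHall_uuE lmN).
rewrite mulr_suml linear_sum !scaler_sumr; apply: eq_bigr => de _.
rewrite mulr_suml linear_sum !scaler_sumr; apply: eq_bigr => n _.
rewrite mulr_suml linear_sum !scaler_sumr; apply: eq_bigr => ga _.
rewrite mulr_suml linear_sum !scaler_sumr; apply: eq_bigr => th _.
rewrite (iHall_Ku hH) -!scalerAl -[u th * _ * _]mulrA (iHall_KK hH) !linearZ /=.
rewrite PhiE !scalerA !rhoLD.
have [->|lE] := eqVneq (fv f de n l) 0; first by rewrite !(mulr0, mul0r) !scale0r.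
have [->|mE] := eqVneq (fv f ga (rhoP de) m) 0.
  by rewrite !(mulr0, mul0r) !scale0r.
have [->|thE] := eqVneq (gv g n ga th) 0; first by rewrite !(mulr0, mul0r) !scale0r.
have {}lE := fv_dim hM hf lE; have {}mE := fv_dim hM hf mE.
have {}thE := gv_dim hM hg thE.
apply: eq_scale_uK => //.
rewrite /iHall_exponent -dimL_rhoP; apply: (Phi_coefE v_neq0).
have := exponentE x y (dimL de) (dimL n) (dimL ga).
by rewrite -lE -thE -dimL_rhoP -mE.
Qed.

Lemma iHall_uK_Ku l x : u l * K x =
  v ^ (- (sym_euler (rhoL x) (dimL l) - sym_euler x (dimL l))) *: (K x * u l).
Proof.
by rewrite (iHall_Ku hH) scalerA -expfzDr ?v_neq0 // addNr expr0z scale1r.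
Qed.

Lemma iHall_span (h : H) : exists (r : seq (L * P)) (t : L * P -> Qv),
  h = \sum_(z <- r) t z *: (u z.2 * K z.1).
Proof.
have [c ->] := basis_span (iHall_basis hH) h.
exists (msupp c), (fun z => c@_z *
  v ^ (sym_euler (rhoL z.1) (dimL z.2) - sym_euler z.1 (dimL z.2))).
by apply: eq_bigr => z _; rewrite (iHall_Ku hH) scalerA.
Qed.

(** The iHall algebra comes with the basis K_x * u_l, in the opposite order, so
    the map is defined there with the commutation factor included. *)
Lemma Phi_exists : exists Phi : {linear H -> extHall Q},
  forall l x, Phi (u l * K x) = v ^ Phi_exponent l x *: uK l (rhoL x).
Proof.
pose e (z : L * P) := sym_euler (rhoL z.1) (dimL z.2) - sym_euler z.1 (dimL z.2).
have [Phi PhiE] := basis_linear (iHall_basis hH)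
  (fun z => v ^ (e z + Phi_exponent z.2 z.1) *: uK z.2 (rhoL z.1)).
exists Phi => l x; rewrite iHall_uK_Ku linearZ /= (PhiE (x, l)) scalerA.
by apply: eq_scale_uK; rewrite // -expfzDr ?v_neq0 // addKr.
Qed.

Lemma Phi_bijective (Phi : {linear H -> extHall Q}) :
    (forall l x, Phi (u l * K x) = v ^ Phi_exponent l x *: uK l (rhoL x)) ->
  bijective Phi.
Proof.
move=> PhiE.
pose Psi := lin_ext (fun s : Bindex Q =>
  v ^ (- Phi_exponent s.1 (rhoL s.2)) *: (u s.1 * K (rhoL s.2))).
have PsiE l x : Psi (uK l x) =
    v ^ (- Phi_exponent l (rhoL x)) *: (u l * K (rhoL x)).
  exact: lin_ext_basis.
exists Psi => [h|c].
  have [r [t ->]] := iHall_span h; rewrite linear_sum.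
  under eq_bigr do rewrite linearZ.
  rewrite /Psi lin_ext_sum; apply: eq_bigr => -[x l] _ /=.
  congr (_ *: _); rewrite PhiE lin_extZ -/(Psi _) PsiE rhoLK scalerA.
  by rewrite -expfzDr ?v_neq0 // subrr expr0z scale1r.
rewrite [c in LHS]malg_sum /Psi lin_ext_sum -/Psi linear_sum [RHS]malg_sum.
apply: eq_bigr => -[l x] _; rewrite linearZ /=; congr (_ *: _).
rewrite -/(uK l x) -/(Psi _) PsiE linearZ /= PhiE rhoLK scalerA.
by rewrite -expfzDr ?v_neq0 // addNr expr0z scale1r.
Qed.

End Products.

Theorem proposition4p1
  (Q : dynkin_iquiver)
  (M : rep_family Q) (hM : is_indec_family M)
  (f g : partition_fun Q -> partition_fun Q -> partition_fun Q -> laurent)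
  (a : partition_fun Q -> laurent)
  (hf : is_hallF_poly M f) (hg : is_hallG_poly M g) (ha : is_hallA_poly M a)
  (H : algType Qv) (K : lattice Q -> H) (u : partition_fun Q -> H)
  (hH : is_iHall_algebra f g a K u) :
  exists Phi : {linear H -> extHall Q},
    [/\ bijective Phi,
        Phi 1 = iHopf_one Q,
        (forall x y : H, Phi (x * y) = iHopf_mul f g a (Phi x) (Phi y)) &
        (forall (l : partition_fun Q) (x : lattice Q),
           Phi (u l * K x) =
           v ^ (sym_euler (dimL l) x + euler x (rhoL x)) *: uK l (rhoL x))].
Proof.
have [Phi PhiE] := Phi_exists hH; exists Phi; split=> //.
- exact: Phi_bijective hH _ PhiE.
- have -> : 1 = u (zeroP Q) * K 0 by rewrite (iHall_K0 hH) (iHall_u0 hH) mulr1.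
  rewrite PhiE /Phi_exponent dimL_zeroP /sym_euler rhoL0 euler0 !addr0 expr0z.
  by rewrite scale1r.
move=> h k.
have [r [s ->]] := iHall_span hH h; have [r' [s' ->]] := iHall_span hH k.
rewrite mulr_suml !linear_sum.
under [X in _ = iHopf_mul _ _ _ X _]eq_bigr do rewrite linearZ /= PhiE scalerA.
under [X in _ = iHopf_mul _ _ _ _ X]eq_bigr do rewrite linearZ /= PhiE scalerA.
rewrite iHopf_mul_sum; apply: eq_bigr => -[x l] _.
rewrite mulr_sumr linear_sum; apply: eq_bigr => -[y m] _ /=.
rewrite -scalerAl -scalerAr !linearZ /= (Phi_mul_basis hM hf hg hH PhiE) !scalerA.
by rewrite mulrACA.
Qed.
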